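(* Let $p\in(0,1)$ and let $R$ be a non-negative integer-valued random variable. Let $(M_n)_{n\in\mathbb{Z}_+}$ be i.i.d. with the same distribution as $R$, with law denoted by $P$, and let $\mathcal{G}$ be the random oriented graph with ranges $(M_n)_{n\in\mathbb{Z}_+}$. For a realization of $\mathcal{G}$, let $P_{\mathcal{G}}$ be the quenched law, under which the graph $\mathcal{G}$ is fixed and the letters $(X_n)_{n\in\mathbb{Z}_+}$ are i.i.d. Bernoulli($p$). Then: 1. If $\displaystyle\limsup_{n\to\infty} nP(R\geq n)<\frac{1}{\min\{p,1-p\}}$, then, for $P$-almost all $\mathcal{G}$, $P_{\mathcal{G}}(\exists v\in\mathbb{Z}_+: W_v=\Xi)=0$. 2. If $\displaystyle\liminf_{n\to\infty} nP(R\geq n)>\frac{3}{\min\{p,1-p\}}$, then, for $P$-almost all $\mathcal{G}$, $P_{\mathcal{G}}(\exists v\in\mathbb{Z}_+: W_v=\Xi)=1$.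
   Context: $\mathbb{Z}_+=\{0,1,2,\dots\}$, $\mathbb{N}=\{1,2,3,\dots\}$. A word is a sequence $\xi=(\xi_1,\xi_2,\dots)\in\Xi:=\{0,1\}^{\mathbb{N}}$. Given ranges $(M_n)_{n\in\mathbb{Z}_+}$, the graph $\mathcal{G}=(\mathbb{Z}_+,\mathcal{E})$ is the oriented graph with edge set $\mathcal{E}=\bigcup_{n\in\mathbb{Z}_+}\{(n,n+i): i\in\mathbb{N},\ 0<i\leq M_n\}$. The letter $X_n\in\{0,1\}$ is assigned to vertex $n$, with $X_n=1$ with probability $p$. The letters are independent of the ranges. A word $\xi$ is seen from a vertex $v_0$ if there is a sequence of distinct vertices $v_1,v_2,\dots$ such that $(v_{i-1},v_i)\in\mathcal{E}$ and $X_{v_i}=\xi_i$ for every $i\geq1$ (the letter at $v_0$ plays no role). For a vertex $v$, $W_v=\{\xi\in\Xi:\xi\text{ is seen from }v\}$. *)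

(* Defs.v *)
From HB Require Import structures.
From mathcomp Require Import all_boot all_order all_algebra finmap.
From mathcomp Require Import all_classical all_reals all_analysis.

Set Implicit Arguments.
Unset Strict Implicit.
Unset Printing Implicit Defensive.

Import Order.TTheory GRing.Theory Num.Theory.

Local Open Scope classical_set_scope.

(* xi : word is the word (xi_1, xi_2, ...) with xi_(i+1) encoded as xi i;
   the letter 1 is true and the letter 0 is false. *)
Definition word := nat -> bool.

Definition edge (M : nat -> nat) (n m : nat) : Prop :=
  exists2 i : nat, 0 < i <= M n & m = n + i.

(* Only the vertices v 1, v 2, ... are required to be distinct. *)
Definition seen_from (M : nat -> nat) (X : nat -> bool) (v0 : nat)
    (xi : word) : Prop :=
  exists v : nat -> nat,
    [/\ v 0 = v0,
        forall i j, 0 < i -> 0 < j -> v i = v j -> i = j,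
        forall i, edge M (v i) (v i.+1) &
        forall i, X (v i.+1) = xi i].

Definition words_seen (M : nat -> nat) (X : nat -> bool) (v : nat) : set word :=
  [set xi | seen_from M X v xi].

Definition some_vertex_sees_all (M : nat -> nat) (X : nat -> bool) : Prop :=
  exists v : nat, words_seen M X v = [set: word].

Definition mutually_independent (d d' : measure_display) (T : measurableType d)
    (T' : measurableType d') (K : realType) (P : probability T K)
    (I : choiceType) (Y : I -> {RV P >-> T'}) : Prop :=
  forall (J : {fset I}) (B : I -> set T'), (forall i, measurable (B i)) ->
    P (\bigcap_(i in [set` J]) (Y i @^-1` B i)) =
    (\prod_(i <- J) P (Y i @^-1` B i))%E.

(* Main.v *)
Require Import Defs.
From HB Require Import structures.
From mathcomp Require Import all_boot all_order all_algebra finmap.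
From mathcomp Require Import all_classical all_reals all_analysis.
From mathcomp Require Import lra zify ring.

Set Implicit Arguments.
Unset Strict Implicit.
Unset Printing Implicit Defensive.

Import Order.TTheory GRing.Theory Num.Theory.
Import numFieldNormedType.Exports.

Local Open Scope classical_set_scope.
Local Open Scope ring_scope.

(** Ranges and letters are handled together, under the product measure: by
    Fubini, a quenched statement for almost every graph is a statement that
    an event of the product space has measure 0 (lemma [ae_xsection0]).
    Since every vertex has finitely many successors, a word is seen as soon as
    all its prefixes are (Konig, [some_vertex_sees_allE]); this makes the
    event measurable and reduces everything to finitely many vertices.  Let
    [r] be the probability of the rarer letter.

    Below the threshold, the constant word in the rarer letter [a] is not
    seen.  If it is seen along a path whose first vertex after the start is
    [u], then every position after [u] is jumped over, or hit, by an edge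
    leaving a vertex of letter [a].  Say that a position is a gap if no vertex
    of letter [a] between [u] and it reaches it.  Gaps form a renewal process:
    position [u + n] is a gap with probability
    [u_n = \prod_(1 <= i <= n) (1 - r * P(R >= i))], and what lies beyond a gap
    is a fresh copy of the process.  Splitting according to the last gap up to
    [N] bounds the probability that there is none among the first [N]
    positions by [1 / \sum_(n <= N) u_n] ([renewal_bound]).  When
    [n * r * P(R >= n) <= 1] for large [n], [u_n] is at least a multiple of
    [1 / n], so this bound tends to 0 ([null_all_seen]).

    Above the threshold, words are read through consecutive windows.  Given a
    window of [l] vertices that are all within reach, let [m] be the largest
    number such that each of the two letters is carried by a vertex of the
    window that reaches [m] vertices past its end; the next window consists of
    these [m] vertices.  One letter is read in each window, whatever the word
    is, so that the windows decide for all words at once ([survives_sees]).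
    The inverse of the window length, cut off for short windows, is a
    supermartingale.  Indeed, if
    [r * P(R >= n) >= 3 / n] for large [n], one given letter reaches fewer than
    [n] vertices past the end with probability at most
    [\prod_(i < l) (1 - 3 / (n + i))], a telescoping product, and summing it
    against [1 / (n * (n - 1))] shows that the inverse of the overshoot of that
    letter has mean about [1 / (2 * l)]; the inverse of [m] is at most the sum
    of two such terms ([layers_le], [overshoot_potential]).  This is where the
    constant 3 comes from.  Hence the windows started with length [l] stay
    nonempty forever with probability at least [1 - L / l], with [L]
    independent of [l] ([survives_bound]).  Almost surely some vertex has a
    range at least [l], and the vertices after the first such vertex are fresh,
    so that all words are seen from it with probability at least [1 - L / l];
    finally [l] is arbitrary ([full_all_seen]).

    All probabilities of events about finitely many vertices are finite sums:
    ranges are truncated at a level [B] too high to affect the event, and the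
    vertices of an interval then become an i.i.d. sequence with values in a
    finite type ([measure_read]). *)

(** * Finite i.i.d. sequences *)

Section IidMean.
Variables (K : realFieldType) (C : finType) (q : C -> K).

(** The mean is integrated one entry at a time, so that conditioning on a
    prefix is a computation ([iid_mean_cat]) and needs no Fubini theorem. *)
Fixpoint iid_mean n (f : seq C -> K) : K :=
  if n is n'.+1 then \sum_c q c * iid_mean n' (fun s => f (c :: s)) else f [::].

Definition iid_prob n (f : pred (seq C)) : K := iid_mean n (fun s => (f s)%:R).

Definition law_prob (A : pred C) : K := \sum_c q c * (A c)%:R.

Lemma eq_iid_mean n f g : (forall s, size s = n -> f s = g s) ->
  iid_mean n f = iid_mean n g.
Proof.
elim: n f g => [|n IHn] f g fg /=; first exact: fg.
apply: eq_bigr => c _; congr (_ * _); apply: IHn => s sn.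
by apply: fg; rewrite /= sn.
Qed.

Lemma iid_mean_cat m n f :
  iid_mean (m + n) f = iid_mean m (fun s => iid_mean n (fun t => f (s ++ t))).
Proof.
elim: m f => [|m IHm] f //=.
by apply: eq_bigr => c _; rewrite IHm.
Qed.

Lemma iid_meanZ n a f : iid_mean n (fun s => a * f s) = a * iid_mean n f.
Proof.
elim: n f => [|n IHn] f //=.
by rewrite mulr_sumr; apply: eq_bigr => c _; rewrite IHn mulrCA.
Qed.

Lemma iid_mean_sum I (r : seq I) (P : pred I) n (F : I -> seq C -> K) :
  iid_mean n (fun s => \sum_(i <- r | P i) F i s)
  = \sum_(i <- r | P i) iid_mean n (F i).
Proof.
elim: n F => [|n IHn] F //=.
rewrite exchange_big; apply: eq_bigr => c _ /=.
by rewrite IHn mulr_sumr.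
Qed.

Lemma iid_meanD n f g :
  iid_mean n (fun s => f s + g s) = iid_mean n f + iid_mean n g.
Proof.
elim: n f g => [|n IHn] f g //=.
by rewrite -big_split; apply: eq_bigr => c _ /=; rewrite IHn mulrDr.
Qed.

Hypothesis q_ge0 : forall c, 0 <= q c.
Hypothesis q_sum1 : \sum_c q c = 1.

Lemma le_iid_mean n f g : (forall s, size s = n -> f s <= g s) ->
  iid_mean n f <= iid_mean n g.
Proof.
elim: n f g => [|n IHn] f g fg /=; first exact: fg.
apply: ler_sum => c _; apply: ler_wpM2l => //; apply: IHn => s sn.
by apply: fg; rewrite /= sn.
Qed.

Lemma iid_mean_cst n a : iid_mean n (fun=> a) = a.
Proof.
elim: n => //= n IHn.
by rewrite -mulr_suml q_sum1 mul1r.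
Qed.

Lemma iid_mean_le n f a : (forall s, size s = n -> f s <= a) -> iid_mean n f <= a.
Proof. by move=> fa; rewrite -[leRHS](iid_mean_cst n); exact: le_iid_mean. Qed.

Lemma iid_prob_ge0 n f : 0 <= iid_prob n f.
Proof.
by rewrite -(iid_mean_cst n 0); apply: le_iid_mean => s _; rewrite ler0n.
Qed.

Lemma iid_prob_le1 n f : iid_prob n f <= 1.
Proof. by apply: iid_mean_le => s _; case: (f s). Qed.

Lemma iid_prob_take m n f :
  iid_prob (m + n) (fun s => f (take m s)) = iid_prob m f.
Proof.
rewrite /iid_prob iid_mean_cat; apply: eq_iid_mean => s sm.
rewrite -[RHS](iid_mean_cst n); apply: eq_iid_mean => t _.
by rewrite take_cat -sm ltnn subnn take0 cats0.
Qed.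

Lemma law_probC A : law_prob (fun c => ~~ A c) = 1 - law_prob A.
Proof.
apply/eqP; rewrite eq_sym subr_eq -big_split -[X in X == _]q_sum1; apply/eqP.
by apply: eq_bigr => c _ /=; case: (A c); rewrite /= ?(mulr0, mulr1, addr0, add0r).
Qed.

(** * Gaps and renewal *)

Section Idle.
Variable rho : C -> nat.

(** No vertex of [s] reaches the [m]-th vertex after its end.  Two cases are
    used: [m = 1] says that the position just after [s] is a gap, and larger
    [m] measures by how much a window is overshot. *)
Fixpoint idle m (s : seq C) : bool :=
  if s is c :: s' then (rho c < size s' + m)%N && idle m s' else true.

Lemma iid_prob_idle m n :
  iid_prob n (idle m) = \prod_(i < n) law_prob (fun c => (rho c < i + m)%N).
Proof.
elim: n => [|n IHn]; first by rewrite big_ord0.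
rewrite big_ord_recr -IHn /= [RHS]mulrC mulr_suml /iid_prob /=.
apply: eq_bigr => c _; rewrite -mulrA; congr (_ * _); rewrite -iid_meanZ.
by apply: eq_iid_mean => s sn; rewrite sn -natrM mulnb.
Qed.

Lemma idle_drop m k s : idle m s -> idle m (drop k s).
Proof. by elim: s k => [|c s IHs] [|k] //= /andP[_]; exact: IHs. Qed.

(** The range starts at 1 because the empty prefix always counts as a gap:
    the process starts afresh there. *)
Definition gapless (s : seq C) : bool :=
  all (fun n => ~~ idle 1 (take n s)) (iota 1 (size s)).

Lemma gapless_take n s : gapless s -> gapless (take n s).
Proof.
move=> /allP gs; apply/allP => i; rewrite mem_iota add1n ltnS size_take_min leq_min.
move=> /and3P[i1 iN isz]; rewrite take_takel//; apply: gs.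
by rewrite mem_iota add1n i1.
Qed.

(** A gap at [m > n] is in particular a gap for the process restarted at [n],
    so two positions cannot both be the last gap. *)
Lemma last_gap_uniq s :
  (\sum_(n < (size s).+1) (idle 1 (take n s) && gapless (drop n s)) <= 1)%N.
Proof.
pose last_gap n := idle 1 (take n s) && gapless (drop n s).
have le_last n m : (n <= size s)%N -> last_gap m -> last_gap n -> (n <= m)%N.
  move=> ns /andP[_ /allP gm] /andP[/(idle_drop m) in_ _].
  rewrite leqNgt; apply/negP => mn.
  have /gm : (n - m)%N \in iota 1 (size (drop m s)).
    by rewrite mem_iota size_drop subn_gt0 mn add1n ltnS leq_sub2r.
  by rewrite take_drop subnK ?(ltnW mn)// in_.
case: (pickP (fun n : 'I_(size s).+1 => last_gap n)) => [n0 g0|g0]; last first.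
  by rewrite big1 // => n _; have := g0 n; rewrite /last_gap => ->.
rewrite (bigD1 n0) //= big1 ?addn0; first by case: (_ && _).
move=> n /eqP nn0; apply/eqP; rewrite eqb0; apply/negP => gn; apply: nn0.
have ns (i : 'I_(size s).+1) : (i <= size s)%N by rewrite -ltnS.
by apply/val_inj/eqP; rewrite eqn_leq (le_last n n0)// (le_last n0 n).
Qed.

(** The prefix up to the last gap and the rest of the sequence are
    independent; having no gap on the shorter rest is at least as likely as
    having none on the whole of [N] positions. *)
Lemma renewal_bound N :
  iid_prob N gapless * \sum_(n < N.+1) iid_prob n (idle 1) <= 1.
Proof.
apply: (@le_trans _ _
  (iid_mean N (fun s => \sum_(n < N.+1)
     (idle 1 (take n s) && gapless (drop n s))%:R))); last first.
  apply: iid_mean_le => s sN; rewrite -natr_sum lern1 -sN.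
  exact: last_gap_uniq.
rewrite mulr_sumr iid_mean_sum; apply: ler_sum => n _.
case: n => n /=; rewrite ltnS => /subnKC <-; move: (N - n)%N => k.
rewrite iid_mean_cat -iid_meanZ; apply: le_iid_mean => s sn.
rewrite (@eq_iid_mean _ _ (fun t => (idle 1 s)%:R * (gapless t)%:R)); last first.
  move=> t _; rewrite take_cat -sn ltnn subnn take0 cats0.
  by rewrite drop_cat ltnn subnn drop0 -natrM mulnb.
rewrite iid_meanZ mulrC ler_wpM2l ?ler0n//.
rewrite addnC -/(iid_prob _ _) -(iid_prob_take k n).
apply: le_iid_mean => t _; rewrite ler_nat.
by case g : (gapless t) => //; rewrite gapless_take.
Qed.
End Idle.
End IidMean.

(** * Exploration by windows *)

Section Windows.
Variables (C : finType) (rho : bool -> C -> nat).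

Definition relayed m s := ~~ idle (rho false) m s && ~~ idle (rho true) m s.

(** Truncating the length of the next window makes the exploration depend on
    finitely many vertices.  Truncation at [l * (l + 1)] costs exactly the
    difference [1 / l - 1 / (l + 1)] that is left over in the mean of the
    inverse length. *)
Definition overshoot_cap l := (l * l.+1)%N.

Definition overshoot l s := (\max_(m < (overshoot_cap l).+1 | relayed m s) m)%N.

Fixpoint survives k l s : bool :=
  if k is k'.+1 then
    let m := overshoot l (take l s) in
    (0 < m)%N && survives k' m (drop l s)
  else true.

(** Number of vertices that suffice to decide [k] steps of the exploration
    from a window of length [l]. *)
Fixpoint horizon k l : nat :=
  if k is k'.+1 then (l + horizon k' (overshoot_cap l))%N else l.

(** Only the first vertex of large range is allowed to start an exploration:
    what follows it is then independent of the choice of the start. *)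
Fixpoint no_start (big : pred C) k l V s : bool :=
  match V, s with
  | V'.+1, c :: s' =>
      if big c then ~~ survives k l s' else no_start big k l V' s'
  | _, _ => true
  end.

Lemma overshoot_relayed l s : (0 < overshoot l s)%N -> relayed (overshoot l s) s.
Proof.
rewrite /overshoot; elim/big_ind: _ => // x y Px Py.
by case: (leqP x y).
Qed.

Lemma overshoot_le_cap l s : (overshoot l s <= overshoot_cap l)%N.
Proof. by apply/bigmax_leqP => m _; rewrite -ltnS. Qed.

Lemma overshoot_lt l s n : (n <= overshoot_cap l)%N ->
  (overshoot l s < n)%N -> ~~ relayed n s.
Proof.
rewrite -ltnS => nl; rewrite ltnNge; apply: contra => rn.
exact: (leq_bigmax_cond (Ordinal nl)).
Qed.

Lemma leq_horizon k l l' : (l <= l')%N -> (horizon k l <= horizon k l')%N.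
Proof.
elim: k l l' => //= k IHk l l' ll'.
by apply: leq_add => //; apply: IHk; rewrite leq_mul.
Qed.

Lemma horizon_ge k l : (l <= horizon k l)%N.
Proof. by case: k => //= k; exact: leq_addr. Qed.
End Windows.

(** * The inverse window length *)

Section Potential.
Variable K : realFieldType.
Implicit Types (L l m n : nat).

Definition potential L l : K := if (l <= L)%N then 1 else L%:R / l%:R.

Lemma potential_ge0 L l : 0 <= potential L l.
Proof. by rewrite /potential; case: ifP => // _; rewrite divr_ge0. Qed.

Lemma sum_telescope_inv L c : (0 < L)%N -> (L <= c)%N ->
  \sum_(L.+1 <= n < c.+1) (n * n.-1)%:R^-1 = L%:R^-1 - c%:R^-1 :> K.
Proof.
move=> L0; elim: c => [|c IHc]; first by rewrite leqNgt L0.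
rewrite leq_eqVlt => /predU1P[->|Lc]; first by rewrite big_geq ?subrr.
have c0 : (0 < c)%N by exact: leq_trans L0 Lc.
rewrite big_nat_recr//= IHc// natrM.
by rewrite -natr1; field; rewrite natr1 !pnatr_eq0 -!lt0n /= L0 c0.
Qed.

(** Layer-cake formula: [1 / m] is the sum of [1 / (n * (n - 1))] over [n > m],
    cut at [c].  It turns the mean of the potential into a sum of
    probabilities. *)
Lemma potential_layers L c m : (0 < L < c)%N -> (m <= c)%N ->
  potential L m = L%:R / c%:R +
    L%:R * \sum_(L.+1 <= n < c.+1) (m < n)%:R / (n * n.-1)%:R.
Proof.
move=> /andP[L0 Lc] mc.
have Lneq0 : L%:R != 0 :> K by rewrite pnatr_eq0 -lt0n.
rewrite /potential; case: leqP => [mL|Lm].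
  under eq_big_nat => n /andP[Ln _] do rewrite (leq_ltn_trans mL Ln) mul1r.
  by rewrite sum_telescope_inv ?(ltnW Lc)// mulrBr addrCA subrr addr0 divff.
rewrite (@big_cat_nat _ _ _ m.+1) ?ltnS//=; last exact: ltnW.
rewrite big_nat big1 => [|n /andP[_]]; last first.
  by rewrite ltnS leqNgt => /negbTE ->; rewrite mul0r.
under eq_big_nat => n /andP[-> _] do rewrite mul1r.
rewrite add0r sum_telescope_inv ?(leq_trans _ Lm)//.
by rewrite mulrBr addrCA subrr addr0.
Qed.

Lemma prod_telescope n l : (3 < n)%N ->
  \prod_(i < l) (1 - 3 / (i + n)%:R) =
  ((n - 3) * (n - 2) * (n - 1))%:R / ((n - 3 + l) * (n - 2 + l) * (n - 1 + l))%:R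
  :> K.
Proof.
case: n => [|[|[|[|x]]]]// _; rewrite !subSS !subn0.
elim: l => [|l IHl].
  by rewrite big_ord0 !addn0 divff // pnatr_eq0 !muln_eq0.
rewrite big_ord_recr IHl /=.
have -> : (l + x.+4)%:R = (x.+1 + l)%:R + 3 :> K by rewrite -natrD; congr (_%:R); lia.
rewrite !addnS !addSn !natrM -!natr1.
by field; rewrite -natrD !natr1 !pnatr_eq0.
Qed.

(** The closed form of the sum of [y / ((y + l) * (y + l + 1) * (y + l + 2))]
    over [y >= x]. *)
Definition tail_sum l x : K :=
  (2 * x%:R + l%:R) / (2 * (x + l)%:R * (x + l).+1%:R).

(** The two sides differ by a factor [(y + 1) / (y + 3)], where [y = n - 3]. *)
Lemma layer_le l n : (3 < n)%N -> (0 < l)%N ->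
  (\prod_(i < l) (1 - 3 / (i + n)%:R)) / (n * n.-1)%:R <=
  tail_sum l (n - 3) - tail_sum l (n - 2).
Proof.
move=> n3 l0; rewrite prod_telescope//.
case: n n3 => [|[|[|[|x]]]]// _.
rewrite !subSS !subn0 /= /tail_sum !addSn !natrM -!natr1 natrD.
set a := l%:R; set b := x%:R.
have a0 : 1 <= a by rewrite ler1n.
have b0 : 0 <= b by rewrite ler0n.
rewrite -subr_ge0.
set e := (X in 0 <= X).
have -> : e = 2 * (b + 1) / ((b + a + 1) * (b + a + 2) * (b + a + 3) * (b + 4)).
  rewrite /e; field.
  by do ?[apply/andP; split]; rewrite gt_eqF //; lra.
by rewrite divr_ge0 // ?mulr_ge0 //; lra.
Qed.

Lemma tail_sum_ge0 l x : 0 <= tail_sum l x.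
Proof. by rewrite divr_ge0 ?addr_ge0 ?mulr_ge0. Qed.

(** Clearing denominators, this is [x <= x ^ 2]. *)
Lemma tail_sum_le l x : (0 < x)%N -> tail_sum l x <= (2 * l.+1%:R)^-1.
Proof.
move=> x0; rewrite /tail_sum.
have x1 : 1 <= x%:R :> K by rewrite ler1n.
have ? : 0 <= l%:R :> K by rewrite ler0n.
rewrite ler_pdivrMr; last by rewrite !mulr_gt0 // ltr0n addn_gt0 x0.
rewrite [leRHS]mulrC ler_pdivlMr; last by rewrite mulr_gt0.
rewrite -!natr1 natrD; nra.
Qed.

Lemma layers_le L l c : (2 < L)%N -> (0 < l)%N -> (L <= c)%N ->
  \sum_(L.+1 <= n < c.+1)
    (\prod_(i < l) (1 - 3 / (i + n)%:R)) / (n * n.-1)%:R <= (2 * l.+1%:R)^-1 :> K.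
Proof.
move=> L2 l0 Lc.
apply: (@le_trans _ _ (\sum_(L.+1 <= n < c.+1)
   (tail_sum l (n - 3) - tail_sum l (n - 2)))).
  rewrite big_nat [leRHS]big_nat; apply: ler_sum => n /andP[Ln _].
  by apply: layer_le => //; exact: leq_trans Ln.
have -> : \sum_(L.+1 <= n < c.+1) (tail_sum l (n - 3) - tail_sum l (n - 2)) =
   tail_sum l (L - 2) - tail_sum l (c - 2).
  rewrite addrC -[X in _ + X]opprK -(telescope_sumr (fun k => - tail_sum l (k - 2))) //.
  rewrite big_add1; apply: eq_big_nat => n /andP[Ln _].
  by rewrite opprK addrC !subSS.
apply: (@le_trans _ _ (tail_sum l (L - 2))).
  by rewrite gerBl tail_sum_ge0.
by apply: tail_sum_le; rewrite subn_gt0.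
Qed.
End Potential.

(** * Survival of the exploration *)

Section Survival.
Variables (K : realFieldType) (C : finType) (q : C -> K).
Hypothesis q_ge0 : forall c, 0 <= q c.
Hypothesis q_sum1 : \sum_c q c = 1.
Variables (rho : bool -> C -> nat) (L B : nat).
Hypothesis L_gt2 : (2 < L)%N.
Hypothesis short_reach : forall a i, (L <= i <= B)%N ->
  law_prob q (fun c => (rho a c < i)%N) <= 1 - 3 / i%:R.

Let idle_bound a n l : (L <= n)%N -> (l + n <= B)%N ->
  iid_prob q l (idle (rho a) n) <= \prod_(i < l) (1 - 3 / (i + n)%:R).
Proof.
move=> Ln lnB; rewrite iid_prob_idle; apply: ler_prod => i _; apply/andP; split.
  by apply: sumr_ge0 => c _; rewrite mulr_ge0.
by apply: short_reach; have := ltn_ord i; lia.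
Qed.

(** One-step supermartingale inequality.  By the union bound, the next window
    is shorter than [n] only if one of the two letters overshoots by less than
    [n]; each letter contributes [1 / (2 * (l + 1))], and the cap contributes
    [1 / l - 1 / (l + 1)]. *)
Lemma overshoot_potential l : (L < l)%N -> (l + overshoot_cap l <= B)%N ->
  iid_mean q l (fun s => potential K L (overshoot rho l s)) <= potential K L l.
Proof.
move=> Ll lB.
have L0 : (0 < L)%N by lia.
have l0 : (0 < l)%N by lia.
have Lc : (L < overshoot_cap l)%N by rewrite /overshoot_cap; nia.
pose w n : K := (n * n.-1)%:R^-1.
have w0 n : 0 <= w n by rewrite invr_ge0.
apply: (@le_trans _ _ (iid_mean q l (fun s => L%:R / (overshoot_cap l)%:R + L%:R *
   \sum_(L.+1 <= n < (overshoot_cap l).+1)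
      (w n * (idle (rho false) n s)%:R + w n * (idle (rho true) n s)%:R)))).
  apply: le_iid_mean => // s _.
  rewrite (@potential_layers K L (overshoot_cap l)) ?overshoot_le_cap ?L0 ?Lc //.
  rewrite lerD2l ler_wpM2l // big_nat [leRHS]big_nat; apply: ler_sum.
  move=> n /andP[_ nc];
  rewrite -mulrDr [leLHS]mulrC ler_wpM2l ?w0 ?invr_ge0 // -natrD ler_nat.
  case: ltnP => // Osn; have := overshoot_lt nc Osn.
  by rewrite /relayed negb_and !negbK; do 2 case: (idle _ _ _).
rewrite iid_meanD iid_mean_cst // iid_meanZ iid_mean_sum.
apply: (@le_trans _ _ (L%:R / (overshoot_cap l)%:R + L%:R * (2 * (2 * l.+1%:R)^-1))).
  rewrite lerD2l ler_wpM2l //.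
  apply: (@le_trans _ _ (2 * \sum_(L.+1 <= n < (overshoot_cap l).+1)
     (\prod_(i < l) (1 - 3 / (i + n)%:R)) / (n * n.-1)%:R)); last first.
    by rewrite ler_wpM2l // (@layers_le _ L l (overshoot_cap l)) // ltnW.
  rewrite mulr_sumr big_nat [leRHS]big_nat; apply: ler_sum => n /andP[Ln nc].
  rewrite iid_meanD !iid_meanZ mulrA -mulrDr mulrC ler_wpM2r //.
  by rewrite mulrDl mul1r lerD // idle_bound; lia.
rewrite /potential leqNgt Ll /= /overshoot_cap natrM -natr1.
have a0 : 0 < l%:R :> K by rewrite ltr0n.
rewrite [leLHS](_ : _ = L%:R / l%:R) //; field.
by rewrite !gt_eqF // addr_gt0.
Qed.

(** The next window is made of vertices that have not been looked at, so the
    inequality iterates; an extinct exploration has potential 1. *)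
Lemma survives_bound k l n : (horizon k l <= n)%N -> (horizon k.+1 l <= B)%N ->
  iid_prob q n (fun s => ~~ survives rho k l s) <= potential K L l.
Proof.
elim: k l n => [|k IHk] l n hn hB.
  by rewrite /iid_prob iid_mean_cst // potential_ge0.
have [lL|Ll] := leqP l L.
  by rewrite /potential lL; exact: iid_prob_le1.
move: hn => /= /subnKC <-; move: (n - _)%N => r; rewrite -addnA.
rewrite /iid_prob iid_mean_cat.
have lB : (l + overshoot_cap l <= B)%N.
  apply: leq_trans hB; rewrite leq_add2l.
  exact: (horizon_ge k.+1).
apply: le_trans (overshoot_potential Ll lB).
apply: le_iid_mean => // s sl.
set m := overshoot rho l s.
have mc : (m <= overshoot_cap l)%N by exact: overshoot_le_cap.
rewrite (@eq_iid_mean _ _ _ _ _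
  (fun t => (~~ ((0 < m)%N && survives rho k m t))%:R)); last first.
  by move=> t _ /=; rewrite take_cat drop_cat sl ltnn subnn take0 drop0 cats0.
have [/= m0|/= m0] := posnP m.
  by rewrite /potential m0 leq0n /= iid_mean_cst.
apply: IHk.
  by apply: leq_trans (leq_addr _ _); exact: leq_horizon.
apply: leq_trans hB; rewrite [leqRHS]/=.
exact: leq_trans (leq_horizon k.+1 mc) (leq_addl _ _).
Qed.

Lemma no_start_bound big k l V n : (V + horizon k l <= n)%N ->
  (horizon k.+1 l <= B)%N ->
  iid_prob q n (no_start rho big k l V)
  <= (1 - law_prob q big) ^+ V + potential K L l.
Proof.
move=> + hB; elim: V n => [|V IHV] [|n] //= hn.
- by rewrite expr0 lerDl potential_ge0.
- by rewrite /iid_prob iid_mean_cst // expr0 lerDl potential_ge0.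
rewrite /iid_prob /=; set E := (1 - _) ^+ V + _ in IHV *.
have E0 : (1 - law_prob q big) ^+ V >= 0.
  by rewrite exprn_ge0 // -law_probC // sumr_ge0 // => c _; rewrite mulr_ge0.
apply: (@le_trans _ _ (\sum_c (q c * (~~ big c)%:R * (1 - law_prob q big) ^+ V
                               + q c * potential K L l))).
  apply: ler_sum => c _; rewrite -mulrA -mulrDr ler_wpM2l //.
  case: (big c) => /=.
    by rewrite mul0r add0r; apply: survives_bound => //; lia.
  by rewrite mul1r; apply: IHV; lia.
rewrite big_split /= -!mulr_suml q_sum1 mul1r lerD2r exprS.
by rewrite -[X in X * _]/(law_prob q (fun c => ~~ big c)) law_probC.
Qed.
End Survival.

(** * Words seen in a fixed graph with fixed letters *)

Section Words.
Local Open Scope nat_scope.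
Variables (M : nat -> nat) (X : nat -> bool).

Fixpoint sees v (s : seq bool) : bool :=
  if s is a :: s' then
    has (fun j => (X j == a) && sees j s') (iota v.+1 (M v))
  else true.

Lemma sees_cat v s t : sees v (s ++ t) -> sees v s.
Proof.
elim: s v => //= a s IHs v /hasP[j jM /andP[Xj sj]].
by apply/hasP; exists j; rewrite // Xj IHs.
Qed.

Lemma edge_iota v j : edge M v j <-> j \in iota v.+1 (M v).
Proof.
rewrite mem_iota addSn ltnS; split=> [[i /andP[i0 iM] ->]|/andP[vj jM]].
  by rewrite -addn1 leq_add2l i0 leq_add2l.
by exists (j - v); [rewrite subn_gt0 vj leq_subLR|rewrite subnKC // ltnW].
Qed.

Lemma path_sees (u : nat -> nat) s : (forall i, edge M (u i) (u i.+1)) ->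
  (forall i, i < size s -> X (u i.+1) = nth false s i) -> sees (u 0) s.
Proof.
elim: s u => //= a s IHs u eu Xu; apply/hasP; exists (u 1).
  exact/edge_iota/eu.
rewrite (Xu 0) ?eqxx //=.
exact: (IHs (fun i => u i.+1) (fun i => eu i.+1) (fun i => Xu i.+1)).
Qed.

Let sees_word (xi : word) i v := forall n, sees v (map xi (iota i n)).

(** Konig: if every successor failed on some prefix, the longest of these
    finitely many prefixes could not be seen from [v]. *)
Lemma sees_word_step xi i v : sees_word xi i v ->
  exists j, [/\ edge M v j, X j = xi i & sees_word xi i.+1 j].
Proof.
move=> vxi; apply: contrapT => no_j.
have /choice[N jN] : forall j, exists n,
    edge M v j -> X j = xi i -> ~~ sees j (map xi (iota i.+1 n)).
  move=> j; apply: contrapT => /forallNP jn; apply: no_j; exists j.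
  have [vj Xj] : edge M v j /\ X j = xi i.
    by have /not_implyP[vj /not_implyP[Xj _]] := jn 0.
  by split=> // n; have /not_implyP[_ /not_implyP[_ /negP/negPn]] := jn n.
have /= /hasP[j vj /andP[/eqP Xj sj]] := vxi (\max_(j <- iota v.+1 (M v)) N j).+1.
have /negP := jN j (proj2 (edge_iota _ _) vj) Xj; apply.
move: sj; rewrite -(subnKC (leq_bigmax_seq (F := N) _ vj isT)) iotaD map_cat.
exact: sees_cat.
Qed.

Lemma sees_wordE xi v : seen_from M X v xi <-> sees_word xi 0 v.
Proof.
split=> [[u [<- _ eu Xu]] n|vxi].
  apply: path_sees => // i; rewrite size_map size_iota => i_n.
  by rewrite (nth_map 0) ?size_iota // nth_iota.
have /choice[next nextP] : forall vi : nat * nat, exists j, sees_word xi vi.2 vi.1 ->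
    [/\ edge M vi.1 j, X j = xi vi.2 & sees_word xi vi.2.+1 j].
  move=> [w i] /=; have [/sees_word_step[j jP]|] := pselect (sees_word xi i w).
    by exists j.
  by exists 0.
pose u := fix u i := if i is i'.+1 then next (u i', i') else v.
have uP i : sees_word xi i (u i) by elim: i => // i /(nextP (u i, i)) [].
have eu i : edge M (u i) (u i.+1) by have [] := nextP (u i, i) (uP i).
exists u; split=> // [i j _ _|i]; last by have [] := nextP (u i, i) (uP i).
have u_incr : {homo u : i k / i < k}.
  apply: homo_ltn => [? ? ?|k]; first exact: ltn_trans.
  by have [d /andP[d0 _] ->] := eu k; rewrite -addn1 leq_add2l.
by move=> uij; case: (ltngtP i j) => // /u_incr; rewrite uij ltnn.
Qed.

Lemma some_vertex_sees_allE :
  some_vertex_sees_all M X <-> exists v, forall s, sees v s.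
Proof.
split=> -[v vP]; exists v.
  move=> s; have : [set: word] (nth false s) by [].
  rewrite -vP => /sees_wordE/(_ (size s)).
  by rewrite map_nth_iota0 // take_size.
by apply/seteqP; split=> // xi _; apply/sees_wordE => n; exact: vP.
Qed.

Definition reach B (a : bool) (c : 'I_B.+1 * bool) : nat :=
  if c.2 == a then nat_of_ord c.1 else 0.

Definition window B v n : seq ('I_B.+1 * bool) :=
  [seq (inord (minn (M j) B), X j) | j <- iota v n].

Lemma size_window B v n : size (window B v n) = n.
Proof. by rewrite size_map size_iota. Qed.

Lemma idle_windowP B a m v n : 0 < m -> n + m <= B.+1 ->
  ~~ idle (@reach B a) m (window B v n) <->
  exists j, [/\ v <= j, j < v + n, X j = a & v + n + m <= j.+1 + M j].
Proof.
move=> m0; elim: n v => [|n IHn] v nB.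
  by split=> // -[j []]; lia.
rewrite /= negb_and size_window; split.
- case/orP=> [|/(IHn _ _)]; last first.
    by case=> [|j [vj jn Xj jM]]; [lia|exists j; split=> //; lia].
  rewrite /reach /= -leqNgt; case: eqP => [Xv|_]; last by lia.
  rewrite inordK ?ltnS ?geq_minr // leq_min => /andP[nM _].
  by exists v; split=> //; lia.
- move=> [j [vj jn Xj jM]]; apply/orP.
  have [vj'|jv] := ltnP v j.
    by right; apply/IHn; [lia|exists j; split=> //; lia].
  have jv' : j = v by lia.
  left; rewrite /reach /= -jv' Xj eqxx -leqNgt inordK ?ltnS ?geq_minr //.
  by rewrite leq_min; apply/andP; split; lia.
Qed.

(** The edge of the path that jumps over a given position starts at a vertex
    of letter [a], and this vertex is not before [w 1]. *)
Lemma gapless_window (a : bool) : some_vertex_sees_all M X ->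
  exists u, forall n B, n <= B -> gapless (@reach B a) (window B u n).
Proof.
move=> [v vX]; have : [set: word] (fun=> a) by [].
rewrite -vX => -[w [_ _ ew Xw]]; exists (w 1) => n B nB.
have w_lt i : w i < w i.+1.
  by have [d /andP[d0 _] ->] := ew i; rewrite -addn1 leq_add2l.
have w_ge i : w 1 + i <= w i.+1.
  by elim: i => [|i IHi]; [rewrite addn0|rewrite addnS (leq_ltn_trans IHi)].
apply/allP => i; rewrite mem_iota size_window => /andP[i1 i_n].
rewrite -map_take take_iota (minn_idPl _); last by lia.
apply/idle_windowP => //; first by lia.
have ex_k : exists k, w 1 + i <= w k.+1 by exists i.
case: (ex_minnP ex_k) => -[|k] ki kmin; first by lia.
exists (w k.+1).
have wk : w k.+1 < w 1 + i by rewrite ltnNge; apply/negP => /kmin; rewrite ltnn.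
split=> //.
- by apply: leq_trans (w_ge k); rewrite leq_addr.
- by have [d /andP[_ dM] def_w] := ew k.+1; lia.
Qed.

(** The vertex [u] where the last letter was read may lie well inside the
    previous window, which ends at [pos]; all that matters is that its range
    covers the whole current window. *)
Lemma survives_sees B k l n u pos s :
  horizon k l <= n -> horizon k.+1 l <= B -> u <= pos -> pos + l <= u + M u ->
  survives (@reach B) k l (window B pos.+1 n) -> size s = k -> sees u s.
Proof.
elim: k l n u pos s => [|k IHk] l n u pos s; first by move=> _ _ _ _ _ /size0nil ->.
move=> hn hB upos posM; case: s => // a s + [sk].
rewrite [survives _ _ _ _]/=.
have ln : l <= n by apply: leq_trans hn => /=; exact: leq_addr.
rewrite -map_take -map_drop take_iota drop_iota (minn_idPl ln).
rewrite -/(window B pos.+1 l) -/(window B (pos.+1 + l) (n - l)).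
set m := overshoot _ _ _ => /andP[m0 sm].
have ml : m <= overshoot_cap l by exact: overshoot_le_cap.
have hm : horizon k m <= horizon k (overshoot_cap l) by exact: leq_horizon.
have hm' : horizon k.+1 m <= horizon k.+1 (overshoot_cap l) by exact: leq_horizon.
have hc := horizon_ge k.+1 (overshoot_cap l).
have hB' : l + horizon k.+1 (overshoot_cap l) <= B by exact: hB.
have : ~~ idle (@reach B a) m (window B pos.+1 l).
  by have /andP[] := overshoot_relayed m0; case: a.
move/idle_windowP => [//||j [posj jl Xj jM]]; first by lia.
apply/hasP; exists j; first by rewrite mem_iota; lia.
rewrite Xj eqxx /=; apply: (IHk m (n - l) j (pos + l)) => //; try lia.
by move: hn => /=; lia.
Qed.

Lemma starts_sees B k l V n v :
  V + horizon k l <= n -> horizon k.+1 l <= B ->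
  ~~ no_start (@reach B) (fun c => l <= c.1) k l V (window B v n) ->
  exists2 u, u < v + V & forall s, size s = k -> sees u s.
Proof.
elim: V n v => [|V IHV] [|n] v hn hB //=.
have lB : l <= B by apply: leq_trans hB; exact: horizon_ge.
rewrite inordK ?ltnS ?geq_minr // leq_min lB andbT.
case: ifP => [lM|_ /IHV]; last first.
  by case=> [||u uV us]; [lia|exact: hB|exists u => //; lia].
rewrite negbK => sv; exists v; first by lia.
by move=> s; apply: (survives_sees (n := n) (pos := v) (l := l)) sv => //; lia.
Qed.

End Words.

(** * Events on finitely many coordinates *)

Lemma measurable_const_event (d : measure_display) (T : measurableType d) (b : bool) :
  measurable [set _ : T | b].
Proof.
have [bT|bF] := boolP b.
  by rewrite (_ : [set _ | _] = setT) //; apply/seteqP; split.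
by rewrite (_ : [set _ | _] = set0) //; apply/seteqP; split=> // w /=; apply/negP.
Qed.

Section CountableQuantifiers.
Variables (d : measure_display) (T : measurableType d) (I : countType).
Variable F : I -> set T.
Hypothesis mF : forall i, measurable (F i).

Lemma measurable_exists : measurable [set w | exists i, F i w].
Proof.
rewrite (_ : [set w | _] = \bigcup_i F i); first exact: countable_bigcupT_measurable.
by apply/seteqP; split=> w [i]; exists i.
Qed.

Lemma measurable_forall : measurable [set w | forall i, F i w].
Proof.
rewrite (_ : [set w | _] = ~` \bigcup_i ~` F i).
  apply: measurableC; apply: countable_bigcupT_measurable => // i.
  exact: measurableC.
apply/seteqP; split=> w wF; first by move=> [i _]; exact.
by move=> i; apply: contrapT => Fi; apply: wF; exists i.
Qed.
End CountableQuantifiers.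

Section FiniteLaw.
Variables (K : realType) (d : measure_display) (Om : measurableType d).
Variable C : finType.

Lemma measure_partition (mu : {measure set Om -> \bar K}) (g : Om -> C)
    (A : set Om) :
  (forall c, measurable [set w | g w = c]) -> measurable A ->
  mu A = (\sum_c mu (A `&` [set w | g w = c]))%E.
Proof.
move=> mg mA; rewrite fsbig_seq ?index_enum_uniq //.
rewrite (_ : [set` index_enum C] = setT); last first.
  by apply/seteqP; split=> c //= _; rewrite mem_index_enum.
rewrite -measure_fin_bigcup //.
- by rewrite -setI_bigcupr; congr (mu _); apply/esym/setIidl => w _; exists (g w).
- exact: finite_finset.
- by move=> c c' _ _ [w [[_ <-] [_ <-]]].
- by move=> c _; exact: measurableI.
Qed.

Lemma finite_law (P : probability Om K) (g : Om -> C) (A : pred C) :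
  (forall c, measurable [set w | g w = c]) ->
  P [set w | A (g w)] = (law_prob (fun c => fine (P [set w | g w = c])) A)%:E.
Proof.
move=> mg; rewrite (measure_partition _ mg) //; last first.
  rewrite (_ : [set w | A (g w)] =
      [set w | exists c, ([set w | g w = c] `&` [set _ | A c]) w]).
    apply: measurable_exists => c; apply: measurableI => //.
    exact: measurable_const_event.
  by apply/seteqP; split=> [w Aw|w [c [/= <-]]]; first by exists (g w).
rewrite /law_prob -sumEFin; apply: eq_bigr => c _; case Ac : (A c).
  rewrite mulr1 fineK ?fin_num_measure //; congr (P _).
  by apply/seteqP; split=> [w []|w /= gw] //; rewrite gw Ac.
rewrite mulr0 (_ : _ `&` _ = set0) ?measure0 //.
by apply/seteqP; split=> // w [/= + gw]; rewrite gw Ac.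
Qed.
End FiniteLaw.

(** * From the sample space to finite i.i.d. sequences *)

Section Transfer.
Variables (K : realType) (d : measure_display) (Om : measurableType d).
Variables (mu : {measure set Om -> \bar K}) (C : finType) (q : C -> K).
Variable z : nat -> Om -> C.
Hypothesis mz : forall j c, measurable [set w | z j w = c].

Let read v n w := [seq z j w | j <- iota v n].

Lemma measurable_read (f : pred (seq C)) v n :
  measurable [set w | f [seq z j w | j <- iota v n]].
Proof.
elim: n v f => [|n IHn] v f /=.
  exact: measurable_const_event.
rewrite (_ : [set w | _] = [set w | exists c, ([set w | z v w = c] `&`
    [set w | f (c :: [seq z j w | j <- iota v.+1 n])]) w]).
  apply: measurable_exists => c; apply: measurableI => //.
  exact: (IHn v.+1 (fun t => f (c :: t))).
by apply/seteqP; split=> [w fw|w [c [/= <-]]]; first by exists (z v w).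
Qed.

Hypothesis cylinder : forall v s,
  mu [set w | [seq z j w | j <- iota v (size s)] = s] = (\prod_(c <- s) q c)%:E.

(** The cylinder in front is what the induction on [n] lengthens. *)
Let cylinder_prob v s n (f : pred (seq C)) :
  mu [set w | (read v (size s) w == s) && f (read (v + size s) n w)]
  = (\prod_(c <- s) q c * iid_prob q n f)%:E.
Proof.
elim: n s f => [|n IHn] s f.
  rewrite /iid_prob /=; case: (f [::]).
    rewrite mulr1 -(cylinder v); congr (mu _); apply/seteqP.
    by split=> w /=; rewrite andbT => /eqP.
  rewrite mulr0 (_ : [set _ | _] = set0) ?measure0 //.
  by apply/seteqP; split=> w //=; rewrite andbF.
rewrite (measure_partition _ (mz (v + size s))) //; last first.
  rewrite (_ : [set _ | _] = [set w | (fun t => (take (size s) t == s) &&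
     f (drop (size s) t)) (read v (size s + n.+1) w)]).
    exact: (@measurable_read (fun t => (take (size s) t == s) &&
      f (drop (size s) t)) v (size s + n.+1)).
  apply/seteqP; split=> w /=; rewrite /read iotaD map_cat.
    by rewrite take_size_cat ?drop_size_cat ?size_map ?size_iota.
  by rewrite take_size_cat ?drop_size_cat ?size_map ?size_iota.
rewrite /iid_prob /= mulr_sumr -sumEFin; apply: eq_bigr => c _.
rewrite mulrA -big_rcons -IHn; congr (mu _).
have rd w : z (v + size s) w = c -> (read v (size (rcons s c)) w == rcons s c) =
    (read v (size s) w == s).
  move=> zc; rewrite size_rcons /read -addn1 iotaD map_cat /= zc cats1.
  by rewrite eqseq_rcons eqxx andbT.
apply/seteqP; split=> w /= => [[/andP[sw fw] zc]|/andP[]].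
  by rewrite rd // sw size_rcons addnS -zc.
rewrite size_rcons /read -addn1 iotaD map_cat cats1 eqseq_rcons => /andP[sw /eqP zc].
by rewrite addn1 addnS sw /= zc.
Qed.

Lemma measure_read v n (f : pred (seq C)) :
  mu [set w | f [seq z j w | j <- iota v n]] = (iid_prob q n f)%:E.
Proof.
have := cylinder_prob v [::] n f; rewrite big_nil mul1r => <-.
by congr (mu _); apply/seteqP; split=> w /=; rewrite addn0.
Qed.
End Transfer.

Lemma measurable_preRV (d d' : measure_display) (T : measurableType d)
    (T' : measurableType d') (K : realType) (P : probability T K)
    (Y : {RV P >-> T'}) (A : set T') :
  measurable A -> measurable (Y @^-1` A).
Proof. by move=> mA; rewrite -[X in measurable X]setTI; exact: measurable_funP. Qed.

(** * Divergence of the renewal series *)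

(** Each factor is eventually at least [i / (i + 1)], so the products dominate a
    multiple of the harmonic sequence. *)
Lemma partial_products_unbounded (K : realType) (b : nat -> K) n0 :
  (forall i, 0 < b i) -> (forall i, (n0 <= i)%N -> 1 - i.+1%:R^-1 <= b i) ->
  forall A, exists N, A < \sum_(n < N.+1) \prod_(i < n) b i.
Proof.
move=> b_gt0 b_ge A.
pose c : K := n0.+1%:R * \prod_(i < n0.+1) b i.
have c_gt0 : 0 < c by rewrite mulr_gt0 ?ltr0n // prodr_gt0.
have prod_ge n : (n0 < n)%N -> c / n%:R <= \prod_(i < n) b i.
  elim: n => // n IHn; rewrite ltnS leq_eqVlt => /predU1P[<-|n0n].
    by rewrite /c mulrAC divff ?mul1r // pnatr_eq0.
  have n_gt0 : 0 < n%:R :> K by rewrite ltr0n (leq_ltn_trans _ n0n).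
  rewrite big_ord_recr /=; apply: le_trans (_ : c / n%:R * (1 - n.+1%:R^-1) <= _).
    rewrite -natr1 le_eqVlt; apply/orP; left; apply/eqP; field.
    by rewrite !gt_eqF // addr_gt0.
  have n1 : n.+1%:R^-1 <= 1 :> K by rewrite invf_le1 // ler1n.
  apply: ler_pM; rewrite ?subr_ge0 ?divr_ge0 ?(ltW c_gt0) //; first exact: IHn.
  by apply: b_ge; exact: ltnW.
have sum_ge N : (n0 <= N)%N ->
    c * (series (@harmonic K) N - series (@harmonic K) n0) <=
    \sum_(n < N.+1) \prod_(i < n) b i.
  elim: N => [|N IHN].
    rewrite leqn0 => /eqP ->; rewrite subrr mulr0 sumr_ge0 // => n _.
    by rewrite ltW // prodr_gt0.
  rewrite leq_eqVlt => /predU1P[->|n0N].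
    by rewrite subrr mulr0 sumr_ge0 // => n _; rewrite ltW // prodr_gt0.
  rewrite seriesS -addrA [X in c * X]addrC mulrDr big_ord_recr /=.
  apply: lerD; first exact: IHN.
  exact: prod_ge.
have : series (@harmonic K) @ \oo --> +oo%R.
  apply: nondecreasing_dvgn_lt; last exact: dvg_harmonic.
  by apply/nondecreasing_seqP => n; rewrite seriesS lerDr ltW // harmonic_gt0.
move/cvgryPgt => /(_ (A / c + series (@harmonic K) n0)) [N _ HN].
exists (maxn N n0); apply: lt_le_trans (sum_ge _ (leq_maxr _ _)).
by rewrite mulrC -ltr_pdivrMr // ltrBrDr; apply: HN => /=; exact: leq_maxl.
Qed.

Section Independence.
Variables (d d' : measure_display) (T : measurableType d) (T' : measurableType d').
Variables (K : realType) (P : probability T K) (Y : nat -> {RV P >-> T'}).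
Hypothesis indep : mutually_independent Y.

Lemma independent_iota v k (A : nat -> set T') : (forall j, measurable (A j)) ->
  P (\bigcap_(j in [set j | (v <= j < v + k)%N]) (Y j @^-1` A j)) =
  (\prod_(j <- iota v k) P (Y j @^-1` A j))%E.
Proof.
move=> mA.
rewrite (_ : [set j | _] = [set` [fset j in iota v k]%fset]); last first.
  by apply/seteqP; split=> j /=; rewrite inE /= mem_iota.
rewrite (indep _ mA); apply: perm_big; apply: uniq_perm => //; first exact: iota_uniq.
by move=> j; rewrite inE.
Qed.
End Independence.

(** * The two regimes *)

Section Model.
Variables (K : realType) (p : K).
Hypothesis hp : 0 < p < 1.
Variables (d0 : measure_display) (T0 : measurableType d0) (P0 : probability T0 K).
Variable R : {RV P0 >-> nat}.
Variables (d : measure_display) (T : measurableType d) (P : probability T K).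
Variable M : nat -> {RV P >-> nat}.
Hypothesis hMindep : mutually_independent M.
Hypothesis hMlaw : forall n, distribution P (M n) =1 distribution P0 R.
Variables (d' : measure_display) (T' : measurableType d') (Q : probability T' K).
Variable X : nat -> {RV Q >-> bool}.
Hypothesis hXindep : mutually_independent X.
Hypothesis hXlaw : forall n, distribution Q (X n) =1 bernoulli_prob p.

Let ranges (w : T * T') n := M n w.1.
Let letters (w : T * T') n := X n w.2.
Let mu : probability (T * T')%type K := (P \x Q)%E.

Definition range_tail n : K := fine (P0 [set w | (n <= R w)%N]).

Definition vertex_law B (c : 'I_B.+1 * bool) : K :=
  fine (P0 [set w | inord (minn (R w) B) = c.1]) * bernoulli_pmf p c.2.

Let measurable_letter j b : measurable [set w | letters w j = b].
Proof.
rewrite (_ : [set w | _] = setT `*` (X j @^-1` [set b])).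
  by apply: measurableX => //; exact: measurable_preRV.
by apply/seteqP; split=> w //= [].
Qed.

Let measurable_range j (A : set nat) : measurable [set w | A (ranges w j)].
Proof.
rewrite (_ : [set w | _] = (M j @^-1` A) `*` setT).
  by apply: measurableX => //; exact: measurable_preRV.
by apply/seteqP; split=> w //= [].
Qed.

Let z B j (w : T * T') : 'I_B.+1 * bool := (inord (minn (ranges w j) B), letters w j).

Let measurable_z B j c : measurable [set w | z B j w = c].
Proof.
rewrite (_ : [set w | _] = [set w | [set m | inord (minn m B) = c.1] (ranges w j)] `&`
    [set w | letters w j = c.2]).
  apply: measurableI; [exact: measurable_range|exact: measurable_letter].
apply/seteqP; split=> w /= => [<-|[h1 h2]] //.
by rewrite /z h1 h2 -surjective_pairing.
Qed.

Let letter_prob j b : Q (X j @^-1` [set b]) = (bernoulli_pmf p b)%:E.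
Proof.
rewrite -[LHS]/(distribution Q (X j) [set b]) hXlaw /bernoulli_prob.
by case/andP: hp => p0 p1; rewrite !ltW //= fsbig_set1.
Qed.

Lemma vertex_law_cylinder B v (s : seq ('I_B.+1 * bool)) :
  mu [set w | [seq z B j w | j <- iota v (size s)] = s] =
  (\prod_(c <- s) vertex_law c)%:E.
Proof.
pose c0 : 'I_B.+1 * bool := (ord0, false).
pose A j := [set m | inord (minn m B) = (nth c0 s (j - v)).1].
pose L j := [set (nth c0 s (j - v)).2].
pose J := [set j | (v <= j < v + size s)%N].
rewrite (_ : [set w | _] = (\bigcap_(j in J) (M j @^-1` A j)) `*`
                           (\bigcap_(j in J) (X j @^-1` L j))); last first.
  have nth_z w i : (i < size s)%N ->
      nth c0 [seq z B j w | j <- iota v (size s)] i = z B (v + i) w.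
    by move=> ij; rewrite (nth_map 0%N) ?size_iota // nth_iota.
  apply/seteqP; split=> w /=.
    move=> def_s; have zs j : J j -> z B j w = nth c0 s (j - v).
      case/andP=> vj js; rewrite -[in RHS]def_s nth_z ?subnKC //.
      by rewrite ltn_subLR.
    by split=> j /zs zj; rewrite /A /L /= -zj.
  move=> [Aw Lw]; apply: (@eq_from_nth _ c0); first by rewrite size_map size_iota.
  move=> i; rewrite size_map size_iota => i_s; rewrite nth_z //.
  have Ji : J (v + i)%N by rewrite /J /= leq_addr ltn_add2l.
  have := Aw _ Ji; have := Lw _ Ji; rewrite /A /L /= addKn /z /ranges /letters => -> ->.
  by case: (nth _ _ _).
have mA j : measurable (A j) by [].
have mL j : measurable (L j) by [].
rewrite [LHS]product_measure1E; last 2 first.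
- by apply: bigcap_measurableType => j _; exact: measurable_preRV.
- by apply: bigcap_measurableType => j _; exact: measurable_preRV.
transitivity ((\prod_(j <- iota v (size s)) P (M j @^-1` A j)) *
   (\prod_(j <- iota v (size s)) Q (X j @^-1` L j)))%E.
  congr (_ * _)%E; [exact: independent_iota hMindep _ _ _ mA|].
  exact: independent_iota hXindep _ _ _ mL.
rewrite -big_split /=.
transitivity (\prod_(j <- iota v (size s)) (vertex_law (nth c0 s (j - v)))%:E)%E.
  apply: eq_bigr => j _.
  rewrite letter_prob -[P _]/(distribution P (M j) (A j)) hMlaw /vertex_law EFinM.
  by rewrite fineK // fin_num_measure //; exact: (measurable_preRV R (mA j)).
rewrite prodEFin [in RHS](big_nth c0) /index_iota subn0.
rewrite -[X in iota X]addn0 iotaDl big_map; congr (_%:E).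
by apply: eq_bigr => i _; rewrite addKn.
Qed.

Lemma vertex_law_prod B (A : pred 'I_B.+1) (D : pred bool) :
  law_prob (@vertex_law B) (fun c => A c.1 && D c.2) =
  fine (P0 [set w | A (inord (minn (R w) B))]) *
  \sum_b bernoulli_pmf p b * (D b)%:R.
Proof.
rewrite (finite_law P0 (g := fun w => inord (minn (R w) B)) A) => [|i]; last first.
  exact: (measurable_preRV R (A := [set m | inord (minn m B) = i])).
rewrite /law_prob /vertex_law /= mulr_suml.
under [RHS]eq_bigr do rewrite mulr_sumr.
rewrite pair_big /=; apply: eq_bigr => -[i b] _ /=.
by rewrite -mulnb natrM mulrACA.
Qed.

Lemma vertex_law_ge0 B (c : 'I_B.+1 * bool) : 0 <= vertex_law c.
Proof.
rewrite mulr_ge0 ?fine_ge0 // bernoulli_pmf_ge0 //.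
by case/andP: hp => p0 p1; rewrite !ltW.
Qed.

Lemma vertex_law_sum1 B : \sum_c @vertex_law B c = 1.
Proof.
have := @vertex_law_prod B predT predT.
rewrite (_ : [set w | _] = setT) ?probability_setT; last by apply/seteqP; split.
rewrite mul1r big_bool /= !mulr1 subrKC => <-.
by apply: eq_bigr => c _; rewrite mulr1.
Qed.

Lemma start_prob B l : (l <= B)%N ->
  law_prob (@vertex_law B) (fun c => l <= c.1)%N = range_tail l.
Proof.
move=> lB; have := @vertex_law_prod B (fun i => l <= i)%N predT.
rewrite big_bool /= !mulr1 subrKC mulr1 => E.
transitivity (law_prob (@vertex_law B) (fun c => (l <= c.1)%N && true)).
  by apply: eq_bigr => c _; rewrite andbT.
rewrite E /range_tail; congr (fine (P0 _)); apply/seteqP.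
by split=> w /=; rewrite inordK ?ltnS ?geq_minr // leq_min lB andbT.
Qed.

(** Truncation at [B] does not affect the events [R >= i] with [i <= B]. *)
Lemma reach_prob B a i : (0 < i <= B)%N ->
  law_prob (@vertex_law B) (fun c => reach a c < i)%N =
  1 - bernoulli_pmf p a * range_tail i.
Proof.
move=> /andP[i0 iB].
have <- : law_prob (@vertex_law B) (fun c => (i <= c.1)%N && (c.2 == a)) =
          bernoulli_pmf p a * range_tail i.
  rewrite (vertex_law_prod (fun j => i <= j)%N (pred1 a)) mulrC; congr (_ * _).
    rewrite (bigD1 a) //= eqxx mulr1 big1 ?addr0 // => b /negbTE /= ->.
    by rewrite mulr0.
  rewrite /range_tail; congr (fine (P0 _)); apply/seteqP.
  by split=> w /=; rewrite inordK ?ltnS ?geq_minr // leq_min iB andbT.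
rewrite -law_probC ?vertex_law_sum1 //; apply: eq_bigr => c _; congr (_ * _%:R).
by rewrite /reach; case: eqP => _; rewrite ?andbT ?andbF ?i0 // -ltnNge.
Qed.

Let measurable_sees v s : measurable [set w | sees (ranges w) (letters w) v s].
Proof.
elim: s v => [|a s IHs] v; first exact: measurable_const_event.
rewrite (_ : [set w | _] = [set w | exists j, ([set w | (v < j <= v + ranges w v)%N] `&`
   ([set w | letters w j = a] `&` [set w | sees (ranges w) (letters w) j s])) w]).
  apply: measurable_exists => j; apply: measurableI.
    exact: (measurable_range v [set m | (v < j <= v + m)%N]).
  by apply: measurableI.
apply/seteqP; split=> w /=.
  move=> /hasP[j]; rewrite mem_iota addSn ltnS => vj /andP[/eqP wj sj].
  by exists j.
move=> [j [vj [wj sj]]]; apply/hasP; exists j; first by rewrite mem_iota addSn ltnS.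
by rewrite wj eqxx.
Qed.

Let all_seen := [set w : T * T' | some_vertex_sees_all (ranges w) (letters w)].

Lemma measurable_all_seen : measurable all_seen.
Proof.
rewrite (_ : all_seen = [set w | exists v, [set w | forall s,
    [set w | sees (ranges w) (letters w) v s] w] w]).
  by apply: measurable_exists => v; apply: measurable_forall => s.
by apply/seteqP; split=> w /some_vertex_sees_allE.
Qed.

Lemma window_prob B v n (f : pred (seq ('I_B.+1 * bool))) :
  mu [set w | f (window (ranges w) (letters w) B v n)] =
  (iid_prob (@vertex_law B) n f)%:E.
Proof.
exact: (measure_read (mu := mu) (@measurable_z B) (@vertex_law_cylinder B) v n f).
Qed.

Lemma measurable_window B v n (f : pred (seq ('I_B.+1 * bool))) :
  measurable [set w | f (window (ranges w) (letters w) B v n)].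
Proof. exact: (measurable_read (@measurable_z B) f v n). Qed.

(** Positivity of all the factors [b i] rests on [p] being strictly between 0
    and 1: even if [R >= i] surely for small [i], gaps have positive
    probability. *)
Lemma null_all_seen a n0 :
  (forall n, (n0 <= n)%N -> bernoulli_pmf p a * range_tail n <= n%:R^-1) ->
  mu all_seen = 0%E.
Proof.
move=> short.
pose gl u n := [set w | gapless (@reach n a) (window (ranges w) (letters w) n u n)].
have mgl u n : measurable (gl u n) by exact: measurable_window.
pose G u := [set w | forall n, gl u n w].
have mG u : measurable (G u) by exact: measurable_forall.
pose b i := 1 - bernoulli_pmf p a * range_tail i.+1.
have G_le u : forall N, fine (mu (G u)) * \sum_(n < N.+1) \prod_(i < n) b i <= 1.
  move=> N; apply: le_trans (renewal_bound (@vertex_law_ge0 N) (vertex_law_sum1 N)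
    (reach a) N).
  have -> : \sum_(n < N.+1) \prod_(i < n) b i =
      \sum_(n < N.+1) iid_prob (@vertex_law N) n (idle (reach a) 1).
    apply: eq_bigr => n _; rewrite iid_prob_idle; apply: eq_bigr => i _.
    by rewrite addn1 reach_prob //= (leq_trans (ltn_ord i)) // -ltnS.
  apply: ler_wpM2r.
    by apply: sumr_ge0 => n _; apply: iid_prob_ge0;
      [exact: vertex_law_ge0|exact: vertex_law_sum1].
  rewrite -lee_fin fineK ?fin_num_measure // -(window_prob u).
  apply: le_measure; [apply: mem_set; exact: (mG u)|
    apply: mem_set; exact: (mgl u N)|by move=> w /(_ N)].
have b_gt0 i : 0 < b i.
  have [p0 p1] := andP hp.
  have t1 : range_tail i.+1 <= 1.
    rewrite -lee_fin fineK ?fin_num_measure ?probability_le1 //.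
    + exact: (measurable_preRV R (A := [set m | (i < m)%N])).
    + exact: (measurable_preRV R (A := [set m | (i < m)%N])).
  have t0 : 0 <= range_tail i.+1 by rewrite fine_ge0.
  by rewrite /b /bernoulli_pmf; case: (a); nra.
have b_ge i : (n0 <= i)%N -> 1 - i.+1%:R^-1 <= b i.
  by move=> n0i; rewrite lerD2l lerN2 short // ltnW.
have G0 u : mu (G u) = 0%E.
  have g0 : 0 <= fine (mu (G u)) by rewrite fine_ge0.
  rewrite -(fineK (fin_num_measure mu _ (mG u))); congr (_%:E).
  apply/eqP; rewrite eq_le g0 andbT leNgt; apply/negP => g_gt0.
  have [N SN] := partial_products_unbounded b_gt0 b_ge (fine (mu (G u)))^-1.
  have := G_le u N; rewrite leNgt => /negP; apply.
  by rewrite mulrC -ltr_pdivrMr // mul1r.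
have mUG : measurable (\bigcup_u G u) by exact: bigcupT_measurable.
have UG0 : mu (\bigcup_u G u) = 0%E.
  apply: measure_negligible => //; apply: negligible_bigcup => u.
  by exists (G u); split=> //; exact: G0.
apply: (subset_measure0 measurable_all_seen mUG); last exact: UG0.
by move=> w /(gapless_window a)[u gu]; exists u => // n; exact: gu.
Qed.

Lemma range_tail_le1 n : range_tail n <= 1.
Proof.
have mR : measurable [set w | (n <= R w)%N].
  exact: (measurable_preRV R (A := [set m | (n <= m)%N])).
by rewrite -lee_fin fineK ?fin_num_measure ?probability_le1.
Qed.

Let sees_long V k := [set w | exists v, (v < V)%N /\
  forall s, size s = k -> sees (ranges w) (letters w) v s].

Let measurable_sees_long V k : measurable (sees_long V k).
Proof.
apply: (measurable_exists (F := fun v => [set w | (v < V)%N /\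
  forall s, size s = k -> sees (ranges w) (letters w) v s])) => v.
apply: measurableI; first exact: measurable_const_event.
apply: (measurable_forall (F := fun s => [set w | size s = k ->
  sees (ranges w) (letters w) v s])) => s.
rewrite (_ : [set w | _] = ~` [set _ | size s == k] `|`
    [set w | sees (ranges w) (letters w) v s]).
  apply: measurableU => //; apply: measurableC; exact: measurable_const_event.
apply/seteqP; split=> w /=; last by case=> // sk /eqP.
by have [sk vw|sk _] := eqVneq (size s) k; [right; exact: vw|left; exact/negP].
Qed.

Let sees_long_decr V : nondecreasing_seq (fun k => ~` sees_long V k).
Proof.
apply/nondecreasing_seqP => k; apply/subsetPset/subsetC => w [v [vV vw]].
exists v; split=> // s sk; apply: (sees_cat (t := [:: false])).
by apply: vw; rewrite cats1 size_rcons sk.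
Qed.

(** The vertex that sees all words of length [k] may vary with [k], but it is
   one of [V] vertices. *)
Let sees_long_all V w : (forall k, sees_long V k w) -> all_seen w.
Proof.
move=> longw; apply/some_vertex_sees_allE; apply: contrapT => /forallNP no_v.
have /choice[s sP] : forall v, exists s, ~ sees (ranges w) (letters w) v s.
  by move=> v; apply/existsNP/no_v.
have [v [vV]] := longw (\max_(v < V) size (s v)).
set k := \max_(_ < _) _ => vw; apply: (sP v).
apply: (sees_cat (t := nseq (k - size (s v)) false)); apply: vw.
rewrite size_cat size_nseq subnKC //.
exact: (leq_bigmax (F := fun v : 'I_V => size (s v)) (Ordinal vV)).
Qed.

(** Without a vertex among the first [V] that sees all words of length [k],
    either these [V] vertices all have ranges less than [l], or the exploration
    from the first exception dies.  The bound does not depend on [k]. *)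
Lemma full_all_seen L : (2 < L)%N ->
  (forall a n, (L <= n)%N -> 3 / n%:R <= bernoulli_pmf p a * range_tail n) ->
  mu (~` all_seen) = 0%E.
Proof.
move=> L2 far.
have miss_le V l k :
    (mu (~` sees_long V k) <= ((1 - range_tail l) ^+ V + potential K L l)%:E)%E.
  pose B := horizon k.+1 l.
  have lB : (l <= B)%N by exact: horizon_ge.
  have short_reach a i : (L <= i <= B)%N ->
      law_prob (@vertex_law B) (fun c => reach a c < i)%N <= 1 - 3 / i%:R.
    move=> /andP[Li iB]; rewrite reach_prob ?lerD2l ?lerN2 ?far //.
    by rewrite iB andbT (leq_trans _ Li) // ltnW // ltnW.
  have := no_start_bound (@vertex_law_ge0 B) (vertex_law_sum1 B) L2 short_reach
    (fun c => (l <= c.1)%N) (leqnn (V + horizon k l)) (leqnn (horizon k.+1 l)).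
  rewrite start_prob // -lee_fin => /(le_trans _); apply.
  rewrite -(window_prob 0); apply: le_measure.
  - by apply: mem_set; exact: measurableC.
  - by apply: mem_set; exact: measurable_window.
  move=> w /=; apply: contra_notT => /starts_sees [//|//|v vV vw].
  by exists v.
have all_le V l :
    (mu (~` all_seen) <= ((1 - range_tail l) ^+ V + potential K L l)%:E)%E.
  have mU : measurable (\bigcup_k ~` sees_long V k).
    by apply: bigcupT_measurable => k; exact: measurableC.
  apply: (@le_trans _ _ (mu (\bigcup_k ~` sees_long V k))).
    apply: le_measure.
    - by apply: mem_set; apply: measurableC; exact: measurable_all_seen.
    - exact: mem_set.
    - move=> w nw; apply: contrapT => no_k; apply: nw.
      apply: (sees_long_all (V := V)) => k; apply: contrapT => kw.
      by apply: no_k; exists k.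
  have cvU : mu \o (fun k => ~` sees_long V k) @ \oo -->
      mu (\bigcup_k ~` sees_long V k).
    apply: nondecreasing_cvg_mu => // k; exact: measurableC.
  rewrite -(cvg_lim _ cvU) //; apply: lime_le; first exact: cvgP cvU.
  by apply: nearW => k; exact: miss_le.
have mA : measurable (~` all_seen).
  by apply: measurableC; exact: measurable_all_seen.
have e0 : 0 <= fine (mu (~` all_seen)) by rewrite fine_ge0.
rewrite -(fineK (fin_num_measure mu _ mA)); congr (_%:E).
apply/eqP; rewrite eq_le e0 andbT leNgt; apply/negP => e_gt0.
set e := fine _ in e0 e_gt0.
have e_le V l : e <= (1 - range_tail l) ^+ V + potential K L l.
  by rewrite -lee_fin fineK ?fin_num_measure.
(* Half of [e] is spent on the potential of [l], the other half on the absence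
   of a start among the first [V] vertices. *)
pose l := maxn L.+1 (Num.bound (2 * L%:R / e)).
have Ll : (L < l)%N by exact: leq_maxl.
have l_gt0 : 0 < l%:R :> K by rewrite ltr0n (leq_ltn_trans _ Ll).
have pot_l : potential K L l < e / 2.
  have : 2 * L%:R / e < l%:R.
    apply: lt_le_trans (archi_boundP _) _; first by rewrite divr_ge0 // mulr_ge0.
    by rewrite ler_nat leq_maxr.
  rewrite ltr_pdivrMr // => e_l.
  by rewrite /potential leqNgt Ll /= ltr_pdivrMr //; lra.
have t_gt0 : 0 < range_tail l.
  have := far true l (ltnW Ll); rewrite /bernoulli_pmf => t_ge.
  have : 0 < p * range_tail l by apply: lt_le_trans t_ge; rewrite divr_gt0.
  by rewrite pmulr_rgt0 //; case/andP: hp.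
have : (1 - range_tail l) ^+ V @[V --> \oo] --> (0 : K).
  apply: cvg_expr; rewrite ger0_norm ?subr_ge0 ?range_tail_le1 //.
  by rewrite gtrBl.
move=> /cvgrPdist_lt /(_ (e / 2)).
rewrite divr_gt0 // => /(_ isT) [V _ /(_ V (leqnn V))].
rewrite /= sub0r normrN ger0_norm ?exprn_ge0 ?subr_ge0 ?range_tail_le1 // => powV.
have := e_le V l; rewrite leNgt => /negP; apply.
by rewrite [ltRHS](splitr e) ltrD.
Qed.

End Model.

(** * The quenched statements *)

Lemma ae_xsection0 (K : realType) (d d' : measure_display)
    (T : measurableType d) (T' : measurableType d')
    (P : probability T K) (Q : probability T' K) (A : set (T * T')) :
  measurable A -> (P \x Q)%E A = 0%E -> {ae P, forall w, Q (xsection A w) = 0%E}.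
Proof.
move=> mA A0.
have mf := measurable_fun_xsection Q mA.
have : (\int[P]_x `|(Q \o xsection A) x|)%E = 0%E.
  by rewrite -A0; apply: eq_integral => w _; rewrite gee0_abs.
move=> /(proj1 (ae_eq_integral_abs P measurableT mf)).
by apply: filterS => w /(_ I).
Qed.

Lemma limn_esup_lt_near (K : realType) (u : (\bar K)^nat) (c : \bar K) :
  (limn_esup u < c)%E -> exists N, forall n, (N <= n)%N -> (u n < c)%E.
Proof.
move=> /ereal_inf_lt[_ [A [N _ NA] <-] Ac]; exists N => n Nn.
by apply: le_lt_trans Ac; apply: ereal_sup_ubound; exists n => //; exact: NA.
Qed.

Lemma limn_einf_gt_near (K : realType) (u : (\bar K)^nat) (c : \bar K) :
  (c < limn_einf u)%E -> exists N, forall n, (N <= n)%N -> (c < u n)%E.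
Proof.
rewrite /limn_einf lteNr => /limn_esup_lt_near[N uN]; exists N => n /uN.
by rewrite lteN2.
Qed.

Theorem corollary1p3 (K : realType) (p : K) (hp : 0 < p < 1)
  (d0 : measure_display) (T0 : measurableType d0) (P0 : probability T0 K)
  (R : {RV P0 >-> nat})
  (d : measure_display) (T : measurableType d) (P : probability T K)
  (M : nat -> {RV P >-> nat})
  (hMindep : mutually_independent M)
  (hMlaw : forall n, distribution P (M n) =1 distribution P0 R)
  (d' : measure_display) (T' : measurableType d') (Q : probability T' K)
  (X : nat -> {RV Q >-> bool})
  (hXindep : mutually_independent X)
  (hXlaw : forall n, distribution Q (X n) =1 bernoulli_prob p) :
  let tail (n : nat) : \bar K :=
    (n%:R%:E * P0 [set w | (n <= R w)%N])%E in
  let all_words_seen (w : T) : set T' :=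
    [set x | some_vertex_sees_all (fun n => M n w) (fun n => X n x)] in
  ((limn_esup tail < ((Num.min p (1 - p))^-1)%:E)%E ->
    {ae P, forall w, measurable (all_words_seen w) /\
                     Q (all_words_seen w) = 0%E}) /\
  ((limn_einf tail > (3 / Num.min p (1 - p))%:E)%E ->
    {ae P, forall w, measurable (all_words_seen w) /\
                     Q (all_words_seen w) = 1%E}).
Proof.
move=> tail all_words_seen; set r := Num.min p (1 - p).
have r_gt0 : 0 < r by case/andP: hp => p0 p1; rewrite lt_min p0 subr_gt0.
have tailE n : tail n = (n%:R * range_tail R n)%:E.
  rewrite /tail EFinM fineK // fin_num_measure //.
  exact: (measurable_preRV R (A := [set m | (n <= m)%N])).
pose E := [set w : T * T' |
  some_vertex_sees_all (fun n => M n w.1) (fun n => X n w.2)].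
have mE : measurable E by exact: measurable_all_seen.
have sectionE w : xsection E w = all_words_seen w.
  by apply/seteqP; split=> x; rewrite /xsection /= inE.
have mS w : measurable (all_words_seen w).
  by rewrite -sectionE; exact: measurable_xsection.
split=> [/limn_esup_lt_near[N tailN]|/limn_einf_gt_near[N tailN]].
  have [a ar] : exists a, bernoulli_pmf p a = r.
    by rewrite /r; case: leP => _; [exists true|exists false].
  have E0 : (P \x Q)%E E = 0%E.
    apply: (null_all_seen hp hMindep hMlaw hXindep hXlaw (a := a) (n0 := maxn N 1)).
    move=> n; rewrite geq_max => /andP[/tailN + n_gt0].
    rewrite tailE lte_fin ar => tn.
    have n0 : 0 < n%:R :> K by rewrite ltr0n.
    rewrite -[leRHS]mul1r ler_pdivlMr // -mulrA -ler_pdivlMl // mulr1.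
    by rewrite mulrC ltW.
  apply: filterS (ae_xsection0 mE E0) => w; rewrite sectionE => ->.
  by split.
have E0 : (P \x Q)%E (~` E) = 0%E.
  apply: (full_all_seen hp hMindep hMlaw hXindep hXlaw (L := maxn N 3)).
    by rewrite leq_max orbT.
  move=> a n; rewrite geq_max => /andP[/tailN + n3].
  rewrite tailE lte_fin => tn.
  have n0 : 0 < n%:R :> K by rewrite ltr0n (leq_trans _ n3).
  have ra : r <= bernoulli_pmf p a.
    by rewrite /r /bernoulli_pmf; case: a; rewrite ge_min lexx ?orbT.
  rewrite ler_pdivrMr // mulrAC -mulrA.
  apply: (@le_trans _ _ (r * (n%:R * range_tail R n))).
    by rewrite mulrC -ler_pdivrMr // ltW.
  rewrite ler_wpM2r //.
  by rewrite mulr_ge0 // fine_ge0.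
have mEC : measurable (~` E) by exact: measurableC.
apply: filterS (ae_xsection0 mEC E0) => w.
rewrite (_ : xsection (~` E) w = ~` all_words_seen w); last first.
  rewrite -sectionE.
  by apply/seteqP; split=> x; rewrite /xsection /= !inE.
move=> Q0; split=> //.
rewrite -(setCK (all_words_seen w)) probability_setC ?Q0 ?sube0 //.
exact: measurableC.
Qed.
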